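(* Let $R$ be an associative ring with identity, $M\in\mathrm{Mod}\,R$ and $n\ge 1$. The following statements are equivalent. (1) $M$ is $n$-SG-projective. (2) There exists an exact sequence $$0\to M\xrightarrow{f_n}P_{n-1}\xrightarrow{f_{n-1}}\cdots\xrightarrow{f_1}P_0\xrightarrow{f_0}M\to 0$$ in $\mathrm{Mod}\,R$ with $P_i$ projective for any $0\le i\le n-1$, such that $\bigoplus_{i=1}^n\mathrm{Im}\, f_i$ is 1-SG-projective. (3) There exists an exact sequence $$0\to M\xrightarrow{f_n}P_{n-1}\xrightarrow{f_{n-1}}\cdots\xrightarrow{f_1}P_0\xrightarrow{f_0}M\to 0$$ in $\mathrm{Mod}\,R$ with $P_i$ projective for any $0\le i\le n-1$, such that $\bigoplus_{i=1}^n\mathrm{Im}\, f_i$ is G-projective. (4) There exists an exact sequence $$0\to M\xrightarrow{f_n}P_{n-1}\xrightarrow{f_{n-1}}\cdots\xrightarrow{f_1}P_0\xrightarrow{f_0}M\to 0$$ in $\mathrm{Mod}\,R$, where $P_i$ has finite projective dimension for any $0\le i\le n-1$, such that $\bigoplus_{i=1}^n\mathrm{Im}\, f_i$ is 1-SG-projective. (5) There exists an exact sequence $$0\to M\xrightarrow{f_n}P_{n-1}\xrightarrow{f_{n-1}}\cdots\xrightarrow{f_1}P_0\xrightarrow{f_0}M\to 0$$ in $\mathrm{Mod}\,R$, where $P_i$ has finite projective dimension for any $0\le i\le n-1$, such that $\bigoplus_{i=1}^n\mathrm{Im}\, f_i$ is G-projective.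
   Context: $\mathrm{Mod}\,R$ is the category of left $R$-modules. For a positive integer $n$, a module $M\in \mathrm{Mod}\,R$ is called $n$-strongly Gorenstein projective ($n$-SG-projective) if there exists an exact sequence $0\to M\to P_{n-1}\to\cdots\to P_0\to M\to 0$ in $\mathrm{Mod}\,R$ with $P_i$ projective for all $0\le i\le n-1$, which remains exact after applying $\mathrm{Hom}_R(-,P)$ for every projective $P\in\mathrm{Mod}\,R$. A module $G\in\mathrm{Mod}\,R$ is called Gorenstein projective (G-projective) if there exists an exact sequence $\cdots\to P_1\to P_0\to P^0\to P^1\to\cdots$ in $\mathrm{Mod}\,R$ with all $P_i,P^i$ projective, which remains exact after applying $\mathrm{Hom}_R(-,P)$ for every projective $P\in\mathrm{Mod}\,R$, and such that $G\cong\mathrm{Im}(P_0\to P^0)$. *)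

(* Defs.v *)
From HB Require Import structures.
From mathcomp Require Import all_boot all_order all_algebra.
From mathcomp Require Import boolp.

Set Implicit Arguments.
Unset Strict Implicit.
Unset Printing Implicit Defensive.

Import GRing.Theory.
Local Open Scope ring_scope.

(* Since R is a pzRingType, the zero ring is allowed; lmodType R is the type of
   left R-modules. *)

Section Image.
Variables (R : pzRingType) (U V : lmodType R) (f : {linear U -> V}).

Definition limage_pred : {pred V} := fun y => `[< exists x, f x = y >].

Lemma limage_predP y : reflect (exists x, f x = y) (y \in limage_pred).
Proof. exact: asboolP. Qed.

Lemma limage_submod_closed : GRing.submod_closed limage_pred.
Proof.
split=> [|a _ _ /limage_predP[x <-] /limage_predP[y <-]].
  by apply/limage_predP; exists 0; rewrite linear0.
by apply/limage_predP; exists (a *: x + y); rewrite linearP.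
Qed.

HB.instance Definition _ :=
  GRing.isSubmodClosed.Build R V limage_pred
    (GRing.submod_closed_semi limage_submod_closed).

Definition limage : Type := {y : V | y \in limage_pred}.

HB.instance Definition _ := SubChoice.on limage.
HB.instance Definition _ := [SubChoice_isSubLmodule of limage by <:].

End Image.

(* For a finite index set the direct sum is the module of all tuples. *)
Section DirectSum.
Variables (R : pzRingType) (n : nat) (M : 'I_n -> lmodType R).

Definition dsum : Type := {dffun forall i : 'I_n, M i}.

HB.instance Definition _ := Choice.on dsum.

Implicit Types u v w : dsum.

Definition dsum_zero : dsum := [ffun i => 0 : M i].
Definition dsum_opp u : dsum := [ffun i => - u i].
Definition dsum_add u v : dsum := [ffun i => u i + v i].
Definition dsum_scale (a : R) u : dsum := [ffun i => a *: u i].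

Lemma dsum_addA : associative dsum_add.
Proof. by move=> u v w; apply/ffunP=> i; rewrite !ffunE addrA. Qed.

Lemma dsum_addC : commutative dsum_add.
Proof. by move=> u v; apply/ffunP=> i; rewrite !ffunE addrC. Qed.

Lemma dsum_add0 : left_id dsum_zero dsum_add.
Proof. by move=> u; apply/ffunP=> i; rewrite !ffunE add0r. Qed.

Lemma dsum_addN : left_inverse dsum_zero dsum_opp dsum_add.
Proof. by move=> u; apply/ffunP=> i; rewrite !ffunE addNr. Qed.

HB.instance Definition _ :=
  GRing.isZmodule.Build dsum dsum_addA dsum_addC dsum_add0 dsum_addN.

Lemma dsum_scaleA a b u : dsum_scale a (dsum_scale b u) = dsum_scale (a * b) u.
Proof. by apply/ffunP=> i; rewrite !ffunE scalerA. Qed.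

Lemma dsum_scale1 : left_id 1 dsum_scale.
Proof. by move=> u; apply/ffunP=> i; rewrite !ffunE scale1r. Qed.

Lemma dsum_scaleDr : right_distributive dsum_scale +%R.
Proof. by move=> a u v; apply/ffunP=> i; rewrite !ffunE scalerDr. Qed.

Lemma dsum_scaleDl u : {morph dsum_scale^~ u : a b / a + b}.
Proof. by move=> a b; apply/ffunP=> i; rewrite !ffunE scalerDl. Qed.

HB.instance Definition _ :=
  GRing.Zmodule_isLmodule.Build R dsum
    dsum_scaleA dsum_scale1 dsum_scaleDr dsum_scaleDl.

End DirectSum.

Section Gorenstein.
Variable R : pzRingType.

Definition projective (P : lmodType R) : Prop :=
  forall (B C : lmodType R) (g : {linear B -> C}) (h : {linear P -> C}),
    (forall c, exists b, g b = c) ->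
    exists k : {linear P -> B}, forall x, g (k x) = h x.

Definition exact_at (A B C : lmodType R)
    (f : {linear A -> B}) (g : {linear B -> C}) : Prop :=
  forall y : B, g y = 0 <-> exists x : A, f x = y.

(* Exactness of Hom(C, Q) -> Hom(B, Q) -> Hom(A, Q) at Hom(B, Q). *)
Definition hom_exact_at (Q A B C : lmodType R)
    (f : {linear A -> B}) (g : {linear B -> C}) : Prop :=
  forall h : {linear B -> Q},
    (forall x, h (f x) = 0) <->
    exists k : {linear C -> Q}, forall y, k (g y) = h y.

(* Finite sequences are indexed by nat, only the terms X 0, ..., X n.+1 and the
   maps f 0, ..., f n being relevant: this says that
     0 -> X n.+1 -(f n)-> X n -> ... -> X 1 -(f 0)-> X 0 -> 0   is exact. *)
Definition exact_seq (n : nat) (X : nat -> lmodType R)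
    (f : forall i, {linear X i.+1 -> X i}) : Prop :=
  [/\ injective (f n),
      forall i, (i < n)%N -> exact_at (f i.+1) (f i)
    & forall y : X 0%N, exists x, f 0%N x = y].

(* Exactness of
     0 -> Hom(X 0, Q) -> Hom(X 1, Q) -> ... -> Hom(X n.+1, Q) -> 0. *)
Definition hom_exact_seq (Q : lmodType R) (n : nat) (X : nat -> lmodType R)
    (f : forall i, {linear X i.+1 -> X i}) : Prop :=
  [/\ forall h : {linear X 0%N -> Q},
        (forall x, h (f 0%N x) = 0) -> forall y, h y = 0,
      forall i, (i < n)%N -> hom_exact_at Q (f i.+1) (f i)
    & forall h : {linear X n.+1 -> Q},
        exists k : {linear X n -> Q}, forall x, k (f n x) = h x].

(* 0 -> M -> P_(n-1) -> ... -> P_0 -> M -> 0 is exact, with P_i = X i.+1 and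
   f_i = f i for i <= n. *)
Definition self_exact_seq (M : lmodType R) (n : nat) (X : nat -> lmodType R)
    (f : forall i, {linear X i.+1 -> X i}) : Prop :=
  [/\ X 0%N = M, X n.+1 = M & exact_seq n f].

Definition SG_projective (n : nat) (M : lmodType R) : Prop :=
  exists (X : nat -> lmodType R) (f : forall i, {linear X i.+1 -> X i}),
    [/\ self_exact_seq M n f,
        forall i, (i < n)%N -> projective (X i.+1)
      & forall Q : lmodType R, projective Q -> hom_exact_seq Q n f].

(* The complex is indexed cohomologically: P_i = X (- i) and P^i = X (i + 1). *)
Definition G_projective (G : lmodType R) : Prop :=
  exists (X : int -> lmodType R) (d : forall i : int, {linear X i -> X (i + 1)}),
    [/\ forall i, projective (X i),
        forall i, exact_at (d i) (d (i + 1)),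
        forall Q : lmodType R, projective Q ->
          forall i, hom_exact_at Q (d i) (d (i + 1))
      & exists phi : {linear G -> limage (d 0)}, bijective phi].

(* There is a resolution 0 -> X m.+1 -> ... -> X 1 -> X 0 = M -> 0 with
   X 1, ..., X m.+1 projective. *)
Definition finite_proj_dim (M : lmodType R) : Prop :=
  exists (m : nat) (X : nat -> lmodType R)
         (f : forall i, {linear X i.+1 -> X i}),
    [/\ X 0%N = M, exact_seq m f
      & forall i, (i <= m)%N -> projective (X i.+1)].

(* Im f_1 (+) ... (+) Im f_n *)
Definition dsum_images (n : nat) (X : nat -> lmodType R)
    (f : forall i, {linear X i.+1 -> X i}) : lmodType R :=
  dsum (fun i : 'I_n => limage (f i.+1)).

End Gorenstein.

(* Main.v *)
Require Import Defs.
From mathcomp Require Import all_boot all_order all_algebra.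
From HB Require Import structures.
From mathcomp Require Import boolp.

Set Implicit Arguments.
Unset Strict Implicit.
Unset Printing Implicit Defensive.

Local Open Scope ring_scope.

Import GRing.Theory.

(** The substance is that a self-exact sequence for M whose middle terms P_i have
finite projective dimension, and whose images I_1, ..., I_n have a Gorenstein
projective direct sum N, already exhibits M as n-SG-projective with the same
maps ([self_exact_SG_projective]).

In a complete resolution of N, exactness of Hom into projective modules passes
to exactness of Hom into every Q of finite projective dimension, by induction
along a resolution of Q.  Hence Ext^1(N, Q) = 0 for all such Q
([G_projective_Ext1_vanishes]), and so Ext^1(I_i, Q) = 0, since each I_i is a
retract of N.  This includes i = 0, because I_0 = M is isomorphic to I_n.  Two
consequences follow.
- P_i is an extension of I_i by I_(i+1), so Ext^1(P_i, Q) = 0 for all Q of finite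
  projective dimension.  Taking for Q the kernel of the first map F -> P_i of a
  finite projective resolution, this splits F -> P_i, and P_i is projective.
- For Q projective, vanishing of Ext^1(I_i, Q) says that maps from I_(i+1) to Q
  extend to P_i, which is exactness of Hom(-, Q) on the sequence.
Only Ext^1 occurs, and only its vanishing, so it is expressed by extending maps
along a kernel ([Ext1_vanishes]); no Ext groups are constructed.

Conversely, if M is n-SG-projective, the sum of the sequences
0 -> I_(i+1) -> P_i -> I_i -> 0 over i < n has the sum of I_1, ..., I_n on the left
and the sum of I_0, ..., I_(n-1) on the right.  As I_0 is isomorphic to I_n, a
cyclic shift identifies both with N ([dsum_images_SG_projective1]).  Finally, a
1-SG-projective module is Gorenstein projective, as its self-extension can be
spliced with itself periodically ([SG_projective1_G_projective]).  So an
n-SG-projective module satisfies the strongest of the four conditions on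
sequences, with projective middle terms and 1-SG-projective sum, and the
first part shows that it suffices to assume the weakest one. *)

(** * Factorization of linear maps *)

Section LinearMaps.
Variable R : pzRingType.
Implicit Types A B C K L P Q U V W : lmodType R.

Definition surjective_map U V (f : {linear U -> V}) : Prop :=
  forall y, exists x, f x = y.

(** Exactness of Hom(V, Q) -> Hom(U, Q) at the maps that vanish on ker u.  Quantifying
over such maps, instead of composing with some map onto ker u, makes the
condition depend on u only. *)
Definition extends_along Q U V (u : {linear U -> V}) : Prop :=
  forall h : {linear U -> Q}, (forall x, u x = 0 -> h x = 0) ->
    exists k : {linear V -> Q}, forall x, k (u x) = h x.

Lemma linear_map_of U V (f : U -> V) :
  linear f -> exists g : {linear U -> V}, g =1 f.
Proof.
move=> lf; pose m := GRing.isLinear.Build R U V *:%R f lf.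
pose g : {linear U -> V} := HB.pack f m.
by exists g.
Qed.

(** A linear map may be defined through arbitrary preimages as soon as its values do
not depend on them.  Maps out of quotients, inverses and corestrictions are all
instances, so that choice has to be reconciled with linearity only once. *)
Lemma lift_along K B Q W (i : {linear K -> B}) (h : {linear K -> Q})
    (z : {linear W -> B}) :
    (forall y, i y = 0 -> h y = 0) -> (forall w, exists y, i y = z w) ->
  exists g : {linear W -> Q}, forall w y, i y = z w -> g w = h y.
Proof.
move=> hi iz.
have hK y y' : i y = i y' -> h y = h y'.
  move=> e; apply/eqP; rewrite -subr_eq0 -linearB; apply/eqP/hi.
  by rewrite linearB e subrr.
have [c cP] := choice iz.
have [|g gE] := @linear_map_of W Q (fun w => h (c w)).
  by move=> a w w' /=; rewrite -linearP; apply: hK; rewrite cP !linearP !cP.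
by exists g => w y e; rewrite gE; apply: hK; rewrite cP e.
Qed.

Lemma surjective_extends_along Q U V (u : {linear U -> V}) :
  surjective_map u -> extends_along Q u.
Proof.
move=> us h hu; have [k kE] := lift_along (z := idfun) hu us.
by exists k => x; apply: kE.
Qed.

Lemma linear_inverse U V (u : {linear U -> V}) :
    injective u -> surjective_map u ->
  exists2 v : {linear V -> U}, cancel u v & cancel v u.
Proof.
move=> ui us.
have [|v vK] := surjective_extends_along us (h := idfun).
  by move=> x; rewrite -(linear0 u) => /ui.
by exists v => // y; have [x <-] := us y; rewrite vK.
Qed.

Lemma corestriction U V (f : {linear U -> V}) :
  exists2 g : {linear U -> limage f},
    (forall x, \val (g x) = f x) & surjective_map g.
Proof.
have [|x|g gE] := @lift_along (limage f) V _ U \val idfun f.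
- by move=> y e; apply: val_inj; rewrite [RHS]linear0; apply: e.
- have fx : f x \in limage_pred f by apply/limage_predP; exists x.
  by exists (exist _ (f x) fx).
have gv x : \val (g x) = f x.
  have fx : f x \in limage_pred f by apply/limage_predP; exists x.
  by rewrite (gE x (exist _ (f x) fx)).
exists g => // y; have /limage_predP[x xy] := valP y.
by exists x; apply: val_inj; rewrite gv.
Qed.

Lemma corestriction_exact U V W (g : {linear U -> V}) (f : {linear V -> W})
    (f' : {linear V -> limage f}) :
  exact_at g f -> (forall x, \val (f' x) = f x) -> exact_at g f'.
Proof.
move=> gf f'E y; rewrite -gf -f'E; split=> [->|]; first exact: linear0.
by move=> e; apply: val_inj; rewrite e linear0.
Qed.

Lemma val_limage_exact U V W (g : {linear U -> V}) (f : {linear V -> W}) :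
  exact_at g f -> exact_at (\val : {linear limage g -> V}) f.
Proof.
move=> gf y; split=> [/gf[x xy]|[x <-]].
  have yg : y \in limage_pred g by apply/limage_predP; exists x.
  by exists (exist _ y yg).
by have /limage_predP gx := valP x; apply/gf.
Qed.

(** U maps onto the image of f with kernel ker f, so maps from the image are the same
as maps from U vanishing on ker f. *)
Lemma extends_along_val Q U V (f : {linear U -> V}) :
  extends_along Q f -> extends_along Q (\val : {linear limage f -> V}).
Proof.
move=> ef h _; have [g gv gs] := corestriction f.
have [|k kE] := ef (h \o g : {linear U -> Q}).
  move=> x fx /=; rewrite (_ : g x = 0) ?linear0 //.
  by apply: val_inj; rewrite [LHS]gv fx linear0.
by exists k => y; have [x <-] := gs y; rewrite -[RHS]kE -gv.
Qed.

End LinearMaps.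

(** * Kernels *)

Section Kernel.
Variables (R : pzRingType) (U V : lmodType R) (f : {linear U -> V}).

Definition lkernel_pred : {pred U} := fun x => f x == 0.

Lemma lkernel_submod_closed : GRing.submod_closed lkernel_pred.
Proof.
split=> [|a x y]; rewrite /in_mem /= /lkernel_pred ?linear0 //.
by move=> /eqP fx /eqP fy; rewrite linearP fx fy scaler0 addr0.
Qed.

HB.instance Definition _ :=
  GRing.isSubmodClosed.Build R U lkernel_pred
    (GRing.submod_closed_semi lkernel_submod_closed).

Definition lkernel : Type := {x : U | x \in lkernel_pred}.

HB.instance Definition _ := SubChoice.on lkernel.
HB.instance Definition _ := [SubChoice_isSubLmodule of lkernel by <:].

Lemma val_lkernel_exact : exact_at (\val : {linear lkernel -> U}) f.
Proof.
move=> y; split=> [fy|[x <-]]; last by apply/eqP; have := valP x.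
have yk : y \in lkernel_pred by apply/eqP.
by exists (exist _ y yk).
Qed.

End Kernel.

(** * Vanishing of the first extension group *)

Section Ext.
Variable R : pzRingType.
Implicit Types A B C K L P Q N : lmodType R.

(** Ext^1(A, Q) = 0, read off the long exact sequence: any map from the kernel of a
surjection onto A to Q extends.  The kernel is only given as the image of some
map i, which need not be injective. *)
Definition Ext1_vanishes A Q : Prop :=
  forall K B (i : {linear K -> B}) (p : {linear B -> A}),
    exact_at i p -> surjective_map p -> extends_along Q i.

(** One projective presentation of A is enough to detect Ext^1(A, Q) = 0.  Given
another surjection p : B -> A, lifting v to l : P -> B makes B a quotient of
K * P, and the extension to B is induced by h on K and by a map k on P that
extends the restriction of h to L. *)
Lemma Ext1_vanishes_cover A Q L P (w : {linear L -> P}) (v : {linear P -> A}) :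
    projective P -> exact_at w v -> surjective_map v -> extends_along Q w ->
  Ext1_vanishes A Q.
Proof.
move=> Pp wv vs ew K B i p ip ps h hi.
have [l lE] := Pp _ _ p v ps.
have [|t tE] := lift_along (z := l \o w) hi.
  by move=> x /=; apply/ip; rewrite lE; apply/wv; exists x.
have [x wx|k kE] := ew t.
  by rewrite (tE x 0) ?linear0 //= wx !linear0.
have [|c cE] := @linear_map_of R (K * P)%type B (fun yx => i yx.1 + l yx.2).
  by move=> a x y /=; rewrite !linearP scalerDr addrACA.
have [|e eE] := @linear_map_of R (K * P)%type Q (fun yx => h yx.1 + k yx.2).
  by move=> a x y /=; rewrite !linearP scalerDr addrACA.
have [b||k' k'E] := @surjective_extends_along _ Q _ _ c _ e.
- have [x vx] := vs (p b).
  have /ip[y iy] : p (b - l x) = 0 by rewrite linearB lE vx subrr.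
  by exists (y, x); rewrite cE /= iy subrK.
- case=> y x; rewrite cE eE /= => iyl.
  (* On the kernel of (y, x) |-> i y + l x the element x comes from z in L with
     l (w z) = - i y, so that k x = k (w z) = h (- y). *)
  have /wv[z zx] : v x = 0.
    have iy0 : p (i y) = 0 by apply/ip; exists y.
    by rewrite -lE -[LHS]add0r -iy0 -linearD iyl linear0.
  rewrite -zx kE (tE z (- y)) ?linearN ?subrr //=.
  by rewrite zx; apply/eqP; rewrite eq_sym -addr_eq0 addrC iyl.
exists k' => y; have := k'E (y, 0).
by rewrite cE eE /= !linear0 !addr0.
Qed.

(** From p : B -> A one gets the surjection (b, x) |-> s (p b - r x) + x from
B * N onto N.  Its kernel is the product of ker p and the image of s, on which h
is prolonged by 0. *)
Lemma Ext1_vanishes_retract A N Q (r : {linear N -> A}) (s : {linear A -> N}) :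
  cancel s r -> Ext1_vanishes N Q -> Ext1_vanishes A Q.
Proof.
move=> sK eN K B i p ip ps h hi.
have [|i' i'E] :=
    @linear_map_of R (K * A)%type (B * N)%type (fun ya => (i ya.1, s ya.2)).
  by move=> a x y /=; rewrite !linearP.
have [|p' p'E] :=
    @linear_map_of R (B * N)%type N (fun bx => s (p bx.1 - r bx.2) + bx.2).
  move=> a x y /=; rewrite scalerDr addrACA; congr (_ + _).
  rewrite -[RHS](linearP s); congr (s _); rewrite !linearP addrACA.
  by rewrite -scalerDr.
have [|||k kE] := eN _ _ i' p' _ _ (h \o fst : {linear (K * A)%type -> Q}).
- move=> [b x]; split=> [|[[y a] <-]]; rewrite p'E ?i'E /=.
    move=> e.
    have pb : p b = 0.
      by have := congr1 r e; rewrite linearD sK linear0 subrK.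
    have [y iy] := (ip b).1 pb; exists (y, r x); rewrite i'E /= iy.
    congr pair; apply/eqP; rewrite eq_sym -subr_eq0; apply/eqP.
    by move: e; rewrite pb sub0r linearN addrC.
  have -> : p (i y) = 0 by apply/ip; exists y.
  by rewrite sK sub0r linearN addNr.
- move=> x; have [b pb] := ps (r x).
  by exists (b, x); rewrite p'E /= pb subrr linear0 add0r.
- by case=> y a; rewrite i'E => -[/hi].
have [|j jE] := @linear_map_of R B (B * N)%type (fun b => (b, 0)).
  by move=> a x y; congr pair; rewrite /= scaler0 addr0.
exists (k \o j : {linear B -> Q}) => y /=; rewrite jE.
by have := kE (y, 0); rewrite i'E /= linear0.
Qed.

Lemma Ext1_vanishes_iso A N Q (u : {linear A -> N}) :
  injective u -> surjective_map u -> Ext1_vanishes N Q <-> Ext1_vanishes A Q.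
Proof.
move=> ui us; have [v uK vK] := linear_inverse ui us.
by split; [apply: (Ext1_vanishes_retract uK) | apply: (Ext1_vanishes_retract vK)].
Qed.

(** For p : E -> B with kernel K, a map K -> Q is extended first to the preimage of A
under p, which is an extension of A by K, and then to E, which is an extension
of C by that preimage. *)
Lemma Ext1_vanishes_extension A B C Q
    (a : {linear A -> B}) (b : {linear B -> C}) :
    injective a -> exact_at a b -> surjective_map b ->
    Ext1_vanishes A Q -> Ext1_vanishes C Q -> Ext1_vanishes B Q.
Proof.
move=> ai ab bs eA eC K E i p ip ps h hi.
pose bp : {linear E -> C} := b \o p.
pose j : {linear lkernel bp -> E} := \val.
have ji : exact_at j bp by apply: val_lkernel_exact.
have j0 x : j x = 0 -> x = 0 by move=> e; apply: val_inj; rewrite linear0.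
have a0 x : a x = 0 -> x = 0 by rewrite -(linear0 a) => /ai.
have [x|q qE] :=
    lift_along (i := a) (h := idfun) (z := p \o j : {linear lkernel bp -> B}) a0.
  by apply/ab; apply/(ji (j x)); exists x.
have [y|t tE] := lift_along (i := j) (h := idfun) (z := i) j0.
  by apply/ji; rewrite /bp /= (_ : p (i y) = 0) ?linear0 //; apply/ip; exists y.
have jt y : j (t y) = i y.
  have [z jz] : exists z, j z = i y.
    by apply/ji; rewrite /bp /= (_ : p (i y) = 0) ?linear0 //; apply/ip; exists y.
  by rewrite (tE _ _ jz).
have aq x : a (q x) = p (j x).
  have [z az] : exists z, a z = p (j x).
    by apply/ab; apply/(ji (j x)); exists x.
  by rewrite (qE _ _ az).
have [|||k kE] := eA _ _ t q _ _ h.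
- move=> x; split=> [qx|[y <-]].
    have /ip[y iy] : p (j x) = 0 by rewrite -aq qx linear0.
    by exists y; apply: val_inj; rewrite -[LHS]/(j _) jt.
  by apply: a0; rewrite aq jt; apply/ip; exists y.
- move=> x; have [e pe] := ps (a x).
  have [z jz] : exists z, j z = e.
    by apply/ji; rewrite /bp /= pe; apply/ab; exists x.
  by exists z; apply: ai; rewrite aq jz.
- by move=> y ty; apply: hi; rewrite -jt ty linear0.
have [||k' k'E] := eC _ _ j bp ji _ k.
- by move=> c; have [y <-] := bs c; have [e <-] := ps y; exists e.
- by move=> x /j0 ->; rewrite linear0.
by exists k' => y; rewrite -kE -k'E jt.
Qed.

End Ext.

(** * Finite projective dimension *)

Section FiniteProjectiveDimension.
Variable R : pzRingType.
Implicit Types A B C K F P Q N : lmodType R.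

(** Finite projective dimension as an inductive predicate: the induction principle
peels off one projective module at a time, and inversion presents the
module as a quotient of a projective by a module of the same kind. *)
Inductive resolvable : lmodType R -> Prop :=
| resolvable_projective P : projective P -> resolvable P
| resolvable_cokernel K F Q (i : {linear K -> F}) (p : {linear F -> Q}) :
    injective i -> exact_at i p -> surjective_map p -> projective F ->
    resolvable K -> resolvable Q.

Lemma projective_retract P A (r : {linear P -> A}) (s : {linear A -> P}) :
  cancel s r -> projective P -> projective A.
Proof.
move=> sK Pp B C g h gs; have [k kE] := Pp B C g (h \o r) gs.
by exists (k \o s : {linear A -> B}) => x /=; rewrite kE /= sK.
Qed.

Lemma finite_proj_dim_resolvable Q : finite_proj_dim Q -> resolvable Q.
Proof.
case=> m [X [f [<- [fi fe fs] Xp]]].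
(* Downward induction on i; the target of f i is replaced by any module that is
   the image of f i up to isomorphism. *)
suff res k : forall i Q' (p : {linear X i.+1 -> Q'}), (i + k)%N = m ->
    surjective_map p -> (forall x, p x = 0 <-> f i x = 0) -> resolvable Q'.
  exact: (res m 0%N _ (f 0%N)).
elim: k => [|k IHk] i Q' p; rewrite ?addn0 ?addnS => im ps pf.
  rewrite -im in fi Xp.
  have pi : injective p.
    move=> x y e; apply: fi; apply/eqP; rewrite -subr_eq0 -linearB.
    by apply/eqP/pf; rewrite linearB e subrr.
  have [s _ sK] := linear_inverse pi ps.
  by apply/resolvable_projective/(projective_retract sK)/Xp.
have lim : (i < m)%N by rewrite -im ltnS leq_addr.
have [c cE cs] := corestriction (f i.+1).
apply: (@resolvable_cokernel (limage (f i.+1)) _ _ \val p) => //.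
- exact: val_inj.
- by move=> y; rewrite pf; apply: val_limage_exact; apply: fe.
- exact/Xp/ltnW.
- apply: (IHk i.+1 _ c) => // x; rewrite -cE.
  by split=> [->|e]; [rewrite linear0 | apply: val_inj; rewrite [LHS]e linear0].
Qed.

Lemma projective_finite_proj_dim P : projective P -> finite_proj_dim P.
Proof.
move=> Pp; exists 0%N, (fun=> P), (fun=> idfun); split=> //.
by split=> // y; exists y.
Qed.

(** In a presentation 0 -> K -> F -> P -> 0 with F projective, K has finite
projective dimension too, so the identity of K extends to F and the sequence
splits. *)
Lemma Ext1_vanishes_projective P :
  resolvable P -> (forall Q, resolvable Q -> Ext1_vanishes P Q) -> projective P.
Proof.
case=> // {P} K F P i p ii ip ps Fp Kr eP.
have [|k kE] := eP _ Kr _ _ i p ip ps idfun.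
  by move=> x; rewrite -(linear0 i) => /ii.
have [|s sE] := surjective_extends_along ps (h := idfun \- (i \o k)).
  by move=> x /ip[y <-] /=; rewrite kE subrr.
apply: (projective_retract (r := p) (s := s)) Fp => x.
have [y <-] := ps x; rewrite sE /= linearB.
by rewrite (_ : p (i (k y)) = 0) ?subr0 //; apply/ip; exists (k y).
Qed.

End FiniteProjectiveDimension.

(** * Gorenstein projective modules *)

Section GorensteinProjective.
Variables (R : pzRingType) (X : int -> lmodType R).
Variable d : forall i : int, {linear X i -> X (i + 1)}.
Hypothesis Xp : forall i, projective (X i).
Hypothesis de : forall i, exact_at (d i) (d (i + 1)).
Hypothesis dh : forall Q : lmodType R, projective Q ->
  forall i, hom_exact_at Q (d i) (d (i + 1)).

(** Hom(X, -) is exact on 0 -> K -> F -> Q -> 0 because the terms of X are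
projective, so exactness of Hom(X, K) and of Hom(X, F) passes to Hom(X, Q).
In the chase, h : X (j + 1) -> Q lifts to h' with values in F; the lift is
corrected by a map g into K to vanish again on ker d, and then factors. *)
Lemma complex_extends_along (Q : lmodType R) :
  resolvable Q -> forall j, extends_along Q (d j).
Proof.
(* The hypotheses give the kernel of d (i + 1) as the image of d i, so j has to be
   written as (j - 1) + 1. *)
have shift (T : lmodType R) :
    (forall j, extends_along T (d (j + 1))) -> forall j, extends_along T (d j).
  by move=> e j; rewrite -(subrK 1 j); apply: e.
have proj (P : lmodType R) : projective P -> forall j, extends_along P (d j).
  move=> Pp; apply: shift => j h hd; apply/(dh Pp) => x.
  by apply: hd; apply/de; exists x.
elim=> {Q} [//|K F Q i p ii ip ps Fp _ IH]; apply: shift => j h hd.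
have [h' h'E] := @Xp (j + 1) _ _ p h ps.
have i0 x : i x = 0 -> x = 0 by rewrite -(linear0 i) => /ii.
have [x|t tE] := lift_along (h := idfun) (z := h' \o d j) i0.
  by apply/ip; rewrite h'E; apply: hd; apply/de; exists x.
have it x : i (t x) = h' (d j x).
  have [y iy] : exists y, i y = h' (d j x).
    by apply/ip; rewrite h'E; apply: hd; apply/de; exists x.
  by rewrite (tE _ _ iy).
have [x dx|g gE] := IH j t; first by apply: i0; rewrite it dx linear0.
have [x|k kE] := proj F Fp (j + 1) (h' \- (i \o g)).
  by move=> /de[y <-] /=; rewrite gE it subrr.
exists (p \o k : {linear _ -> _}) => x /=; rewrite kE /= linearB h'E.
by rewrite (_ : p (i (g x)) = 0) ?subr0 //; apply/ip; exists (g x).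
Qed.

Lemma complex_Ext1_vanishes (Q : lmodType R) j :
  resolvable Q -> Ext1_vanishes (limage (d (j + 1))) Q.
Proof.
move=> Qr; have [c cE cs] := corestriction (d (j + 1)).
apply: (Ext1_vanishes_cover (w := d j) (v := c)) => //.
  exact: corestriction_exact.
exact: complex_extends_along.
Qed.

End GorensteinProjective.

Lemma G_projective_Ext1_vanishes (R : pzRingType) (G Q : lmodType R) :
  G_projective G -> resolvable Q -> Ext1_vanishes G Q.
Proof.
case=> X [d [Xp de dh [phi phib]]] Qr.
have /Ext1_vanishes_iso <- : injective phi by exact: bij_inj.
  (* limage (d 0) is an instance at j = -1, as -1 + 1 computes to 0. *)
  exact: (@complex_Ext1_vanishes _ _ _ Xp de dh Q (- 1)).
by case: phib => psi _ psiK y; exists (psi y).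
Qed.

(** * Self-exact sequences and 1-SG-projective modules *)

Section SelfExtension.
Variable R : pzRingType.
Implicit Types N P Q : lmodType R.

Lemma hom_exact_seqP Q n (X : nat -> lmodType R)
    (f : forall i, {linear X i.+1 -> X i}) :
    exact_seq n f ->
  hom_exact_seq Q n f <-> forall i, (i <= n)%N -> extends_along Q (f i).
Proof.
move=> [fi fe fs]; split=> [[_ he hn] i|fh].
  rewrite leq_eqVlt => /orP[/eqP-> h _|lin h hf]; first exact: hn.
  by apply/(he i lin) => x; apply: hf; apply/(fe i lin); exists x.
split=> [h hf y|i lin h|h]; first by have [x <-] := fs y.
  split=> [hf|[k kE] x].
    by apply: fh; [exact: ltnW | move=> y /(fe i lin)[x <-]].
  have ff : f i (f i.+1 x) = 0 by apply/(fe i lin); exists x.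
  by rewrite -kE ff linear0.
by apply: fh => // x; rewrite -(linear0 (f n)) => /fi ->; rewrite linear0.
Qed.

(** Eliminates the equations between modules at the two ends of the sequence. *)
Lemma SG_projective1P N :
  SG_projective 1 N <->
  exists P (a : {linear N -> P}) (b : {linear P -> N}),
    [/\ injective a, exact_at a b, surjective_map b, projective P
      & forall Q, projective Q -> extends_along Q a].
Proof.
split=> [[X [f [[X0 X2 fex] Xp fh]]]|[P [a [b [ai ab bs Pp ae]]]]].
  have f1h Q : projective Q -> extends_along Q (f 1%N).
    by move=> /fh/(hom_exact_seqP Q fex); apply.
  have [f1 fe f0] := fex; have f01 := fe 0%N isT; have X1 := Xp 0%N isT.
  move: (f 0%N) (f 1%N) f0 f1 f01 f1h => {fe fex fh Xp f}.
  move: (X 0%N) (X 1%N) (X 2) X0 X2 X1 => X0 P X2 -> -> Pp b a bs ai ab ae.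
  by exists P, a, b.
pose X i := if i is 1%N then P else N.
pose f i : {linear X i.+1 -> X i} :=
  match i return {linear X i.+1 -> X i} with 0%N => b | 1%N => a | _ => \0 end.
have fex : exact_seq 1 f by split=> // -[].
exists X, f; split=> // [[]//|Q Qp].
apply/(hom_exact_seqP _ fex) => -[|[]]// _; last exact: ae.
exact: surjective_extends_along.
Qed.

(** Splicing 0 -> N -> P -> N -> 0 with itself gives the periodic complete resolution
with all differentials equal to a \o b. *)
Lemma SG_projective1_G_projective N : SG_projective 1 N -> G_projective N.
Proof.
case/SG_projective1P=> P [a [b [ai ab bs Pp ae]]].
have a0 x : a x = 0 -> x = 0 by rewrite -(linear0 a) => /ai.
exists (fun=> P), (fun=> a \o b); split=> // [_|Q Qp _|].
- move=> y; split=> [/a0/ab[z <-]|[x <-]] /=.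
    by have [x <-] := bs z; exists x.
  by rewrite (_ : b (a (b x)) = 0) ?linear0 //; apply/ab; exists (b x).
- move=> h; split=> [hab|[k kE] x /=]; last first.
    rewrite -kE /= (_ : b (a (b x)) = 0) ?linear0 //.
    by apply/ab; exists (b x).
  have [x|g gE] := surjective_extends_along bs (h := h).
    by move=> /ab[y <-]; have [z <-] := bs y; apply: hab.
  have [x|k kE] := ae Q Qp g; first by move/a0 ->; rewrite linear0.
  by exists k => y /=; rewrite kE gE.
have [c cE cs] := corestriction (a \o b : {linear P -> P}).
have [x bx|phi phiE] := surjective_extends_along bs (h := c).
  by apply: val_inj; rewrite cE /= bx !linear0.
have phiv x : \val (phi x) = a x.
  by have [y <-] := bs x; rewrite phiE cE.
have phii : injective phi.
  by move=> x y /(congr1 \val); rewrite !phiv => /ai.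
have [|psi psiK phiK] := linear_inverse phii; last by exists phi, psi.
by move=> y; have [x <-] := cs y; exists (b x); rewrite phiE.
Qed.
End SelfExtension.

(** * Finite direct sums *)

Section DirectSums.
Variables (R : pzRingType) (n : nat).
Implicit Types (P A : 'I_n -> lmodType R) (B C Q : lmodType R).

Definition dsum_proj P i (u : dsum P) : P i := u i.

Lemma dsum_proj_linear P i : linear (@dsum_proj P i).
Proof. by move=> a u v; rewrite /dsum_proj !ffunE. Qed.

HB.instance Definition _ P i :=
  GRing.isLinear.Build R (dsum P) (P i) *:%R (@dsum_proj P i)
    (@dsum_proj_linear P i).

Definition dsum_in P i (x : P i) : dsum P :=
  [ffun j => dfwith (fun k => 0 : P k) x j].

Lemma dsum_in_linear P i : linear (@dsum_in P i).
Proof.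
move=> a x y; apply/ffunP => j; rewrite !ffunE.
have [<-|ij] := eqVneq i j; first by rewrite !dfwith_in.
by rewrite !dfwith_out // scaler0 addr0.
Qed.

HB.instance Definition _ P i :=
  GRing.isLinear.Build R (P i) (dsum P) *:%R (@dsum_in P i)
    (@dsum_in_linear P i).

Lemma dsum_inK P i : cancel (@dsum_in P i) (@dsum_proj P i).
Proof. by move=> x; rewrite /dsum_proj ffunE dfwith_in. Qed.

Lemma dsum_decomposition P (u : dsum P) : u = \sum_i dsum_in (u i).
Proof.
apply/ffunP => j; rewrite -[RHS]/(dsum_proj j _) raddf_sum (bigD1 j) //=.
rewrite dsum_inK big1 ?addr0 // => i ij.
by rewrite /dsum_proj ffunE dfwith_out.
Qed.

Lemma dsum_copairing P Q (k : forall i, {linear P i -> Q}) :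
  exists h : {linear dsum P -> Q}, forall u, h u = \sum_i k i (u i).
Proof.
have [|h hE] := @linear_map_of R (dsum P) Q (fun u => \sum_i k i (u i)).
  move=> a u v; rewrite scaler_sumr -big_split /=; apply: eq_bigr => i _.
  by rewrite !ffunE linearP.
by exists h.
Qed.

Lemma projective_dsum P : (forall i, projective (P i)) -> projective (dsum P).
Proof.
move=> Pp B C g h gs.
pose k i := cid (Pp i B C g (h \o @dsum_in P i) gs).
have [K KE] := dsum_copairing (fun i => projT1 (k i)).
exists K => u; rewrite KE [in RHS](dsum_decomposition u) !linear_sum.
by apply: eq_bigr => i _; rewrite (projT2 (k i)).
Qed.

(** The sequences 0 -> A (s i) -> P (s i) -> A i -> 0 join different summands, but
as s is a permutation their sum begins and ends with the same module. *)
Lemma dsum_SG_projective1 A P (s : 'I_n -> 'I_n)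
    (a : forall i, {linear A i -> P i})
    (b : forall i, {linear P (s i) -> A i}) :
    bijective s -> (forall i, injective (a i)) ->
    (forall i, exact_at (a (s i)) (b i)) -> (forall i, surjective_map (b i)) ->
    (forall i, projective (P i)) ->
    (forall Q, projective Q -> forall i, extends_along Q (a i)) ->
  SG_projective 1 (dsum A).
Proof.
move=> sb ai ab bs Pp ae; have [s' sK s'K] := sb.
have [|a' a'E] := @linear_map_of R (dsum A) (dsum P)
    (fun u => [ffun i => a i (u i)]).
  by move=> c u v; apply/ffunP => i; rewrite !ffunE linearP.
have [|b' b'E] := @linear_map_of R (dsum P) (dsum A)
    (fun u => [ffun i => b i (u (s i))]).
  by move=> c u v; apply/ffunP => i; rewrite !ffunE linearP.
have a'i : injective a'.
  move=> u v e; apply/ffunP => i; apply: (ai i).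
  by have /ffunP/(_ i) := e; rewrite !a'E !ffunE.
apply/SG_projective1P; exists (dsum P), a', b'; split=> //.
- move=> u; split=> [u0|[x <-]]; last first.
    apply/ffunP => i; rewrite b'E !ffunE a'E ffunE.
    by apply/(ab i); exists (x (s i)).
  have us i : exists x, a i x = u i.
    rewrite -(s'K i); apply/(ab (s' i)).
    by have /ffunP/(_ (s' i)) := u0; rewrite b'E !ffunE.
  exists [ffun i => projT1 (cid (us i))]; apply/ffunP => i.
  by rewrite a'E !ffunE (projT2 (cid (us i))).
- move=> y.
  (* The component i of a preimage of y is constrained by b j for the unique j with
     s j = i; quantifying over u avoids transporting x along that equation. *)
  have xs i : exists x : P i, forall j (u : dsum P),
      s j = i -> u i = x -> b j (u (s j)) = y j.
    rewrite -(s'K i); have [x bx] := bs (s' i) (y (s' i)).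
    by exists x => j u /(bij_inj sb) -> ->.
  exists [ffun i => projT1 (cid (xs i))]; apply/ffunP => j.
  rewrite b'E ffunE; apply: (projT2 (cid (xs (s j)))) => //.
  by rewrite ffunE.
- exact: projective_dsum.
move=> Q Qp h _.
have a0 i x : a i x = 0 -> (h \o @dsum_in A i) x = 0.
  by rewrite -(linear0 (a i)) => /ai ->; rewrite linear0.
pose k i := cid (ae Q Qp i _ (a0 i)).
have [K KE] := dsum_copairing (fun i => projT1 (k i)).
exists K => u; rewrite KE a'E [in RHS](dsum_decomposition u) linear_sum.
by apply: eq_bigr => i _; rewrite ffunE (projT2 (k i)).
Qed.

End DirectSums.

(** * Images in a self-exact sequence *)

Section SelfExactSequence.
Variables (R : pzRingType) (M : lmodType R) (n : nat).
Variables (X : nat -> lmodType R) (f : forall i, {linear X i.+1 -> X i}).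
Hypothesis Mf : self_exact_seq M n f.

(** The sequence ending in Im f_j, for j = 1, ..., n - 1, starts with Im f_(j+1).
The one ending in Im f_n starts with Im f_1: it is 0 -> Im f_1 -> P_0 -> M -> 0,
with M identified with Im f_n by f_n.  The summands are therefore linked by the
cyclic successor [ordS]. *)
Lemma dsum_images_SG_projective1 :
    (forall i, (i < n)%N -> projective (X i.+1)) ->
    (forall Q, projective Q -> hom_exact_seq Q n f) ->
  SG_projective 1 (dsum_images n f).
Proof.
case: Mf => X0 Xn fex Xp fh; have [fi fe fs] := fex.
have bE (j : 'I_n) : exists b : {linear X (ordS j).+1 -> limage (f j.+1)},
    exact_at (f (ordS j).+1) b /\ surjective_map b.
  have [c cE cs] := corestriction (f j.+1).
  have [/eqP jn|jn] := boolP (j.+1 == n); last first.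
    have {}jn : (j.+1 < n)%N by rewrite ltn_neqAle jn ltn_ord.
    have -> : ordS j = j.+1 :> nat by rewrite /= modn_small.
    by exists c; split=> //; apply: corestriction_exact => //; apply: fe.
  have -> : ordS j = 0%N :> nat by rewrite /= jn modnn.
  (* Here j = n - 1, and the projection is f_n after f_0 : P_0 -> M. *)
  have X0j : X 0%N = X j.+2 by rewrite jn Xn.
  have f1 := fe 0%N (leq_ltn_trans (leq0n j) (ltn_ord j)).
  have f0 := fs; move: (f 0%N) f1 f0.
  rewrite X0j => f0 f1 f0s; exists (c \o f0); split=> y.
    rewrite -f1 /=; split=> [cf|->]; last by rewrite linear0.
    have fji : injective (f j.+1) by rewrite jn.
    by apply: fji; rewrite -cE cf !linear0.
  by have [x <-] := cs y; have [z <-] := f0s x; exists z.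
pose b j := projT1 (cid (bE j)); pose bP j := projT2 (cid (bE j)).
apply: (@dsum_SG_projective1 _ _ _ (fun j : 'I_n => X j.+1) (@ordS n)
  (fun j : 'I_n => \val : {linear limage (f j.+1) -> X j.+1}) b) => //.
- exact: ordS_bij.
- by move=> j; apply: val_inj.
- by move=> j; apply: val_limage_exact; case: (bP j).
- by move=> j; case: (bP j).
- by move=> j; apply: Xp.
move=> Q Qp j; apply: extends_along_val.
by have /hom_exact_seqP := fh Q Qp; apply.
Qed.

(** Im f_1, ..., Im f_n are retracts of the sum, and Im f_0 = M is isomorphic to
Im f_n because f_n is injective. *)
Lemma images_Ext1_vanishes Q :
    Ext1_vanishes (dsum_images n f) Q -> (0 < n)%N ->
  forall i, (i <= n)%N -> Ext1_vanishes (limage (f i)) Q.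
Proof.
case: Mf => X0 Xn [fi fe fs] eQ n0.
have e i : (i < n)%N -> Ext1_vanishes (limage (f i.+1)) Q.
  move=> lin.
  exact: (Ext1_vanishes_retract
    (@dsum_inK _ _ (fun j : 'I_n => limage (f j.+1)) (Ordinal lin)) eQ).
case=> [_|i lin]; last exact: e lin.
have [c cE cs] := corestriction (f n).
have ci : injective c by move=> x y /(congr1 \val); rewrite !cE => /fi.
have vs : surjective_map (\val : {linear limage (f 0%N) -> X 0%N}).
  move=> y; have yf : y \in limage_pred (f 0%N) by apply/limage_predP.
  by exists (exist _ y yf).
apply/(Ext1_vanishes_iso Q val_inj vs); rewrite X0 -Xn.
by apply/(Ext1_vanishes_iso Q ci cs); case: (n) n0 e => // m _; apply.
Qed.

(** Ext^1 of all images vanishes on modules of finite projective dimension, which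
makes the middle terms projective, being extensions of images, and makes
Hom(-, Q) exact on the sequence for Q projective. *)
Lemma self_exact_SG_projective :
    (0 < n)%N -> (forall i, (i < n)%N -> finite_proj_dim (X i.+1)) ->
    G_projective (dsum_images n f) ->
  SG_projective n M.
Proof.
move=> n0 Xfpd NG; exists X, f; have [X0 Xn fex] := Mf.
have [fi fe fs] := fex.
have eI Q : resolvable Q ->
    forall i, (i <= n)%N -> Ext1_vanishes (limage (f i)) Q.
  by move=> Qr; apply/images_Ext1_vanishes/n0/G_projective_Ext1_vanishes.
split=> // [i lin|Q Qp].
  apply: Ext1_vanishes_projective => [|Q Qr].
    exact/finite_proj_dim_resolvable/Xfpd.
  have [c cE cs] := corestriction (f i).
  apply: (@Ext1_vanishes_extension _ (limage (f i.+1)) _ _ _ \val c) => //.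
  - exact: val_inj.
  - by apply/val_limage_exact/corestriction_exact => //; apply: fe.
  - exact: eI.
  - exact/eI/ltnW.
apply/(hom_exact_seqP Q fex) => -[_|i lin]; first exact: surjective_extends_along.
have [c cE cs] := corestriction (f i).
apply: (eI Q (resolvable_projective Qp) i (ltnW lin) _ _ _ c) => //.
by apply: corestriction_exact => //; apply: fe.
Qed.

End SelfExactSequence.

Theorem theorem3p9 (R : pzRingType) (M : lmodType R) (n : nat) (hn : (1 <= n)%N) :
  [<-> SG_projective n M;
       exists (X : nat -> lmodType R) (f : forall i, {linear X i.+1 -> X i}),
         [/\ self_exact_seq M n f,
             forall i, (i < n)%N -> projective (X i.+1)
           & SG_projective 1%N (dsum_images n f)];
       exists (X : nat -> lmodType R) (f : forall i, {linear X i.+1 -> X i}),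
         [/\ self_exact_seq M n f,
             forall i, (i < n)%N -> projective (X i.+1)
           & G_projective (dsum_images n f)];
       exists (X : nat -> lmodType R) (f : forall i, {linear X i.+1 -> X i}),
         [/\ self_exact_seq M n f,
             forall i, (i < n)%N -> finite_proj_dim (X i.+1)
           & SG_projective 1%N (dsum_images n f)];
       exists (X : nat -> lmodType R) (f : forall i, {linear X i.+1 -> X i}),
         [/\ self_exact_seq M n f,
             forall i, (i < n)%N -> finite_proj_dim (X i.+1)
           & G_projective (dsum_images n f)]].
Proof.
have SG_images : SG_projective n M ->
    exists (X : nat -> lmodType R) (f : forall i, {linear X i.+1 -> X i}),
      [/\ self_exact_seq M n f,
          forall i, (i < n)%N -> projective (X i.+1)
        & SG_projective 1%N (dsum_images n f)].
  case=> X [f [Mf Xp fh]]; exists X, f; split=> //.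
  exact: dsum_images_SG_projective1 Mf Xp fh.
tfae=> //.
- case=> X [f [Mf Xp NSG]]; exists X, f; split=> //.
  exact: SG_projective1_G_projective.
- case=> X [f [Mf Xp NG]].
  have [|X' [f' [Mf' X'p NSG]]] := SG_images.
    apply: (self_exact_SG_projective Mf hn _ NG) => i lin.
    exact/projective_finite_proj_dim/Xp.
  exists X', f'; split=> // i lin.
  exact/projective_finite_proj_dim/X'p.
- case=> X [f [Mf Xp NSG]]; exists X, f; split=> //.
  exact: SG_projective1_G_projective.
by case=> X [f [Mf Xp NG]]; apply: self_exact_SG_projective Mf hn Xp NG.
Qed.
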